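(* Let $q\in\mathbb{C}$ with $|q|<1$, $r\in\mathbb{N}$, $n\in\mathbb{Z}_{\ge 0}$, and $x\in\mathbb{R}$ with $x\notin\{0,-1,-2,\ldots\}$. Define $E^{(r)}_{n,q}(x)$ by the generating function $$[2]_q^r\sum_{m_1,\ldots,m_r=0}^{\infty}(-q)^{m_1+\cdots+m_r}e^{[m_1+\cdots+m_r+x]_q t}=\sum_{n=0}^{\infty}E^{(r)}_{n,q}(x)\frac{t^n}{n!},$$ and the multiple $q$-zeta function $$\zeta_{q,r}(s,x)=[2]_q^r\sum_{m_1,\ldots,m_r=0}^{\infty}\frac{(-q)^{m_1+\cdots+m_r}}{[m_1+\cdots+m_r+x]_q^s},\qquad s\in\mathbb{C}.$$ Then $\zeta_{q,r}(-n,x)=E^{(r)}_{n,q}(x)$.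
   Context: For $y\in\mathbb{C}$, $[y]_q=\frac{1-q^y}{1-q}$, where $q^y=e^{y\log q}$ for a fixed choice of $\log q$; $[2]_q=1+q$. *)

(* Defs.v *)
From HB Require Import structures.
From mathcomp Require Export all_boot all_order all_algebra.
From mathcomp Require Export complex.
From mathcomp Require Export all_classical all_reals all_analysis.
From mathcomp Require summability.

Set Implicit Arguments.
Unset Strict Implicit.
Unset Printing Implicit Defensive.

Import Order.TTheory GRing.Theory Num.Theory.
Import numFieldNormedType.Exports.

Local Open Scope classical_set_scope.
Local Open Scope ring_scope.
Local Open Scope complex_scope.

Section Defs.
Variable R : realType.
Local Notation C := R[i].

Definition cexp (z : C) : C :=
  (expR (complex.Re z))%:C * (cos (complex.Im z) +i* sin (complex.Im z)).

(* A logarithm on C \ {0}, with no branch singled out and no regularity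
   required: [w ^ s] below is relative to such a choice. *)
Definition is_logarithm (Log : C -> C) : Prop :=
  forall w, w != 0 -> cexp (Log w) = w.

Definition cpow (Log : C -> C) (w s : C) : C := cexp (s * Log w).

(* [logq] is the fixed choice of log q, so that q^y = e^(y log q). *)
Definition qnum (q logq y : C) : C := (1 - cexp (y * logq)) / (1 - q).

(* The unordered sum over all (m_1, ..., m_r) in N^r, i.e. the limit of the
   finite partial sums along the finite subsets of N^r ordered by inclusion. *)
Definition multisum (r : nat) (f : r.-tuple nat -> C) : C :=
  @summability.sum (r.-tuple nat) C C^o f.

Definition qEuler_gf (q logq : C) (r : nat) (x : R) (t : C) : C :=
  qnum q logq 2 ^+ r *
  multisum (fun m : r.-tuple nat =>
    (- q) ^+ sumn m * cexp (qnum q logq ((sumn m)%:R + x%:C) * t)).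

(* The sequence E such that, for every complex t, the power series
   \sum_n E_n t^n / n! converges to the generating function at t. *)
Definition qEuler (q logq : C) (r : nat) (x : R) : nat -> C :=
  xget (fun=> 0) [set E : nat -> C | forall t : C,
    series (fun n => E n * (t ^+ n / n`!%:R) : C^o) @ \oo
      --> (qEuler_gf q logq r x t : C^o)].

Definition qzeta (Log : C -> C) (q logq : C) (r : nat) (s : C) (x : R) : C :=
  qnum q logq 2 ^+ r *
  multisum (fun m : r.-tuple nat =>
    (- q) ^+ sumn m / cpow Log (qnum q logq ((sumn m)%:R + x%:C)) s).

End Defs.

(* Main.v *)
Require Import Defs.
From mathcomp Require Import finmap ring lra.

Import Order.TTheory GRing.Theory Num.Theory.
Import numFieldNormedType.Exports.
Import ComplexField.Normc summability.

Set Implicit Arguments.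
Unset Strict Implicit.
Unset Printing Implicit Defensive.

Local Open Scope classical_set_scope.
Local Open Scope ring_scope.
Local Open Scope complex_scope.

(* Since [Log] is a logarithm and [[m + x]_q] never vanishes (its numerator
   [1 - q^(m + x)] has [|q^(m + x)| <> 1]), the value of the zeta function at
   [-n] is the moment [[2]_q^r * \sum_m (-q)^|m| [|m| + x]_q^n].  The q-numbers
   [[|m| + x]_q] are bounded uniformly in [m] and the weights [(-q)^|m|] are
   absolutely summable over N^r, so the exponential series can be summed term
   by term: the moments are coefficients of the generating function, and the
   coefficients of an everywhere convergent power series are unique. *)

(** * The real-valued modulus on [R[i]] and convergence in terms of it *)

Lemma normc_ge0 (R : realType) (z : R[i]) : 0 <= normc z.
Proof. by case: z => a b; rewrite sqrtr_ge0. Qed.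

Lemma ler_normcD (R : realType) (y z : R[i]) : normc (y + z) <= normc y + normc z.
Proof. exact: le_normcD. Qed.

Lemma normc_sum (R : realType) (I : Type) (s : seq I) (P : pred I) (f : I -> R[i]) :
  normc (\sum_(i <- s | P i) f i) <= \sum_(i <- s | P i) normc (f i).
Proof.
elim/big_rec2: _ => [|i x y _ le_yx]; first by rewrite normc0.
by rewrite (le_trans (ler_normcD _ _))// lerD2l.
Qed.

Lemma normcX (R : realType) (z : R[i]) n : normc (z ^+ n) = normc z ^+ n.
Proof. by elim: n => [|n IH]; rewrite ?expr0 ?normc1// !exprS normcM IH. Qed.

Lemma normcR (R : realType) (a : R) : normc a%:C = `|a|.
Proof. by rewrite /normc/= expr0n addr0 sqrtr_sqr. Qed.

Lemma normc_nat (R : realType) n : normc (n%:R : R[i]) = n%:R.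
Proof. by rewrite -[n%:R](rmorph_nat (real_complex R)) normcR normr_nat. Qed.

Lemma normc_ReIm (R : realType) (z : R[i]) :
  normc z <= `|complex.Re z| + `|complex.Im z|.
Proof.
rewrite [z in normc z]complexE (le_trans (ler_normcD _ _))// normcM !normcR.
by rewrite -[X in X * _]/(Num.sqrt (0 ^+ 2 + 1 ^+ 2)) expr0n expr1n add0r sqrtr1 mul1r.
Qed.

Lemma normRe_le_normc (R : realType) (z : R[i]) : `|complex.Re z| <= normc z.
Proof. by rewrite -lecR; exact: normc_ge_Re. Qed.

Lemma normIm_le_normc (R : realType) (z : R[i]) : `|complex.Im z| <= normc z.
Proof.
case: z => a b /=; rewrite -sqrtr_sqr ler_sqrt ?addr_ge0 ?sqr_ge0//.
by rewrite lerDr sqr_ge0.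
Qed.

(** The norm of [R[i]^o] takes values in [R[i]], so its convergence quantifies over complex [e]. In
    that order [0 < e] forces a zero imaginary part and a positive real part, so real [e]
    suffice. *)
Lemma cvg_normcP (R : realType) (T : Type) (F : set_system T) {FF : Filter F}
    (f : T -> R[i]) (l : R[i]) :
  f @ F --> (l : R[i]^o) <->
  forall e : R, 0 < e -> \forall x \near F, normc (l - f x) <= e.
Proof.
have PF := @cvgrPdist_le R[i] R[i]^o T F FF f l.
split=> [/PF fl e e0|fl].
  have eC0 : 0 < e%:C by rewrite ltcR.
  by apply: filterS (fl _ eC0) => x; rewrite -lecR.
apply/PF => e; rewrite ltcE/= => /andP[/eqP Ime Ree].
apply: filterS (fl _ Ree) => x; rewrite -lecR => /le_trans; apply.
by rewrite lecE/= Ime eqxx lexx.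
Qed.

Lemma normc_cvg_le (R : realType) (T : Type) (F : set_system T) {FF : ProperFilter F}
    (f : T -> R[i]) (l : R[i]) M :
  f @ F --> (l : R[i]^o) -> (forall x, normc (f x) <= M) -> normc l <= M.
Proof.
move=> /cvg_normcP fl fM; apply/ler_addgt0Pr => e e0.
have [x lx] := filter_ex (fl _ e0).
by rewrite -[l](subrK (f x)) (le_trans (ler_normcD _ _))// addrC lerD.
Qed.

Lemma cvg_ReIm (R : realType) (T : Type) (F : set_system T) {FF : Filter F}
    (f : T -> R[i]) (a b : R) :
  (fun x => complex.Re (f x)) @ F --> a -> (fun x => complex.Im (f x)) @ F --> b ->
  f @ F --> (a +i* b : R[i]^o).
Proof.
move=> /cvgrPdist_le fa /cvgrPdist_le fb; apply/cvg_normcP => e e0.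
have e20 : 0 < e / 2 by rewrite divr_gt0.
apply: filterS2 (fa _ e20) (fb _ e20) => x xa xb.
apply: le_trans (normc_ReIm _) _; rewrite [e]splitr.
by case: (f x) xa xb => u v /= xa xb; rewrite lerD.
Qed.

(** * Unordered sums: convergence by domination *)

Lemma partial_sumE (I : choiceType) (V : zmodType) (f : I -> V) (A : {fset I}) :
  partial_sum f A = \sum_(i <- A) f i.
Proof. by rewrite big_seq_fsetE. Qed.

(** Up to permutation, [s] is the part of [s'] lying in [s]; the remaining terms contribute
    nonnegatively. *)
Lemma ler_sum_uniq_sub (R : numDomainType) (I : eqType) (s s' : seq I) (f : I -> R) :
  uniq s -> uniq s' -> {subset s <= s'} -> (forall i, 0 <= f i) ->
  \sum_(i <- s) f i <= \sum_(i <- s') f i.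
Proof.
move=> us us' ss' f0; rewrite [leRHS](bigID (mem s))/=.
rewrite [leLHS](_ : _ = \sum_(i <- s' | i \in s) f i) ?lerDl ?sumr_ge0//.
rewrite -[RHS]big_filter; apply: perm_big; apply: uniq_perm; rewrite ?filter_uniq//.
by move=> i; rewrite mem_filter; case: (boolP (i \in s)) => //= /ss' ->.
Qed.

(** With nonnegative terms the partial sums form a monotone bounded net: once a finite subset comes
    within [e] of the supremum, all larger ones do. *)
Lemma partial_sum_cvg_nneg (R : realType) (I : choiceType) (f : I -> R) M :
  (forall i, 0 <= f i) -> (forall A : {fset I}, partial_sum f A <= M) ->
  partial_sum f @ totally --> sup (range (partial_sum f)).
Proof.
move=> f0 fM; set S := range _.
have S0 : S !=set0 by exists (partial_sum f fset0); exists fset0.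
have hS : has_sup S by split => //; exists M => _ [A _ <-].
have FF := @totally_filter I.
apply/cvgrPdist_le => e e0.
have [_ [A _ <-] ltA] := sup_adherent e0 hS.
exists A => // B /= /fsubsetP AB.
have leB : partial_sum f B <= sup S by apply: (sup_upper_bound hS); exists B.
rewrite ger0_norm ?subr_ge0// lerBlDr -lerBlDl (le_trans (ltW ltA))//.
by rewrite !partial_sumE ler_sum_uniq_sub.
Qed.

(** Write [f] as [(f + g) - g]: both families are nonnegative, with partial sums bounded by [M *+ 2]
    and [M], which reduces to the monotone case. *)
Lemma partial_sum_cvg_dominated (R : realType) (I : choiceType) (f g : I -> R) M :
  (forall i, `|f i| <= g i) -> (forall A : {fset I}, partial_sum g A <= M) ->
  exists l : R, partial_sum f @ totally --> l.
Proof.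
move=> fg gM; have g0 i : 0 <= g i by apply: le_trans (fg i).
have FF := @totally_filter I.
have fDg0 i : 0 <= f i + g i.
  by have := fg i; rewrite ler_norml => /andP[+ _]; rewrite -subr_ge0 opprK.
have fDgM (A : {fset I}) : partial_sum (fun i => f i + g i) A <= M *+ 2.
  rewrite /partial_sum big_split/= mulr2n lerD//; last exact: gM.
  apply: le_trans (gM A); apply: ler_sum => i _.
  by apply: le_trans (fg _); rewrite ler_norm.
have cfg := partial_sum_cvg_nneg fDg0 fDgM; have cg := partial_sum_cvg_nneg g0 gM.
have -> : partial_sum f = partial_sum (fun i => f i + g i) - partial_sum g.
  by apply/funext => A; rewrite !fctE /partial_sum big_split/= addrK.
by eexists; exact: cvgB cfg cg.
Qed.

Lemma Re_sum (R : realType) (I : Type) (s : seq I) (P : pred I) (f : I -> R[i]) :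
  complex.Re (\sum_(i <- s | P i) f i) = \sum_(i <- s | P i) complex.Re (f i).
Proof. by elim/big_rec2: _ => // i y z _ <-; case: (f i) z => a b []. Qed.

Lemma Im_sum (R : realType) (I : Type) (s : seq I) (P : pred I) (f : I -> R[i]) :
  complex.Im (\sum_(i <- s | P i) f i) = \sum_(i <- s | P i) complex.Im (f i).
Proof. by elim/big_rec2: _ => // i y z _ <-; case: (f i) z => a b []. Qed.

(** The majorant [g] also dominates the real and imaginary parts, so a limit exists. Since [sum] is
    defined as a [lim], uniqueness of limits identifies it with that limit. *)
Lemma complex_partial_sum_cvg_dominated (R : realType) (I : choiceType)
    (f : I -> R[i]) (g : I -> R) M :
  (forall i, normc (f i) <= g i) -> (forall A : {fset I}, partial_sum g A <= M) ->
  partial_sum f @ totally --> (@sum I R[i] R[i]^o f : R[i]^o).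
Proof.
move=> fg gM; have FF := @totally_filter I.
have [i|a fa] := @partial_sum_cvg_dominated _ _ (fun i => complex.Re (f i)) g M _ gM.
  exact: le_trans (normRe_le_normc _) (fg i).
have [i|b fb] := @partial_sum_cvg_dominated _ _ (fun i => complex.Im (f i)) g M _ gM.
  exact: le_trans (normIm_le_normc _) (fg i).
have fab : partial_sum f @ totally --> (a +i* b : R[i]^o).
  apply: cvg_ReIm.
  - by under eq_fun do rewrite Re_sum; exact: fa.
  - by under eq_fun do rewrite Im_sum; exact: fb.
have -> : @sum I R[i] R[i]^o f = a +i* b.
  exact: (@cvg_lim R[i]^o (@norm_hausdorff _ R[i]^o) _ _ (@totally_filter I)).
exact: fab.
Qed.

(** * Algebra and modulus of the complex exponential *)

Lemma cexpD (R : realType) (y z : R[i]) : cexp (y + z) = cexp y * cexp z.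
Proof.
case: y z => [a b] [c d]; rewrite /cexp /= expRD cosD sinD.
apply/eqP; rewrite eq_complex /=; apply/andP; split; apply/eqP; ring.
Qed.

Lemma cexp0 (R : realType) : cexp (0 : R[i]) = 1.
Proof.
rewrite /cexp /= expR0 cos0 sin0.
by apply/eqP; rewrite eq_complex /= !mul1r !mul0r subr0 addr0 !eqxx.
Qed.

Lemma cexp_natl (R : realType) (z : R[i]) n : cexp (n%:R * z) = cexp z ^+ n.
Proof.
elim: n => [|n IH]; first by rewrite mul0r cexp0 expr0.
by rewrite -natr1 mulrDl mul1r cexpD IH exprSr.
Qed.

Lemma normc_cexp (R : realType) (z : R[i]) : normc (cexp z) = expR (complex.Re z).
Proof.
rewrite /cexp normcM normcR ger0_norm ?expR_ge0//=.
by rewrite cos2Dsin2 sqrtr1 mulr1.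
Qed.

Lemma cexp_neq0 (R : realType) (z : R[i]) : cexp z != 0.
Proof.
apply/eqP => z0; have := expR_gt0 (complex.Re z).
by rewrite -normc_cexp z0 normc0 ltxx.
Qed.

Lemma cexpN (R : realType) (z : R[i]) : cexp (- z) = (cexp z)^-1.
Proof.
by apply: (mulfI (cexp_neq0 z)); rewrite -cexpD subrr cexp0 mulfV ?cexp_neq0.
Qed.

(** * Truncated exponentials and their convergence to [cexp] *)

(** Generic in the field, so that the same identities apply to a complex argument and to its real
    modulus. *)
Definition exp_partial (F : fieldType) (N : nat) (z : F) : F :=
  \sum_(n < N) z ^+ n / n`!%:R.

Lemma exp_partialS (F : fieldType) N (z : F) :
  exp_partial N.+1 z = exp_partial N z + z ^+ N / N`!%:R.
Proof. exact: big_ord_recr. Qed.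

Lemma exp_partial_sub (F : fieldType) M N (z : F) : (M <= N)%N ->
  exp_partial N z - exp_partial M z = \sum_(M <= n < N) z ^+ n / n`!%:R.
Proof.
move=> MN; rewrite /exp_partial -!(big_mkord xpredT (fun n => z ^+ n / n`!%:R)).
by rewrite (big_cat_nat (leq0n M) MN)/= addrAC subrr add0r.
Qed.

(** The right side sums a^i b^j / (i! j!) over the triangle i + j < N. Raising [N] by one adds the
    diagonal i + j = N, which the binomial theorem identifies with (a + b)^N / N!. *)
Lemma exp_partialD (F : numFieldType) N (a b : F) :
  exp_partial N (a + b) = \sum_(i < N) a ^+ i / i`!%:R * exp_partial (N - i) b.
Proof.
elim: N => [|N IH]; first by rewrite /exp_partial !big_ord0.
rewrite exp_partialS IH big_ord_recr/= subSn// subnn exp_partialS /exp_partial.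
rewrite big_ord0 add0r [in RHS](eq_bigr (fun i : 'I_N =>
    a ^+ i / i`!%:R * exp_partial (N - i) b +
    a ^+ i / i`!%:R * (b ^+ (N - i) / (N - i)`!%:R))); last first.
  by move=> i _; rewrite subSn 1?ltnW// -mulrDr -exp_partialS.
rewrite big_split/= -addrA; congr (_ + _).
(* The isolated last term is the i = N entry of the diagonal, so the diagonal becomes a single sum
   over N + 1 indices. *)
have -> : b ^+ 0 / 0`!%:R = b ^+ (N - N) / (N - N)`!%:R by rewrite subnn.
rewrite -(big_ord_recr N (fun i => a ^+ i / i`!%:R * (b ^+ (N - i) / (N - i)`!%:R))).
rewrite addrC exprDn mulr_suml; apply: eq_bigr => i _.
have iN : (i <= N)%N by rewrite -ltnS.
have f0 k : (k`!%:R : F) != 0 by rewrite pnatr_eq0 -lt0n fact_gt0.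
rewrite -(bin_fact iN) !natrM -[_ *+ _]mulr_natr.
have c0 : ('C(N, i)%:R : F) != 0 by rewrite pnatr_eq0 -lt0n bin_gt0.
by field; rewrite !f0 c0.
Qed.

(** Square minus triangle: what remains are the terms a^i b^j / (i! j!) with i, j < N and i + j >=
    N. *)
Lemma exp_partial_mul_sub (F : numFieldType) N (a b : F) :
  exp_partial N a * exp_partial N b - exp_partial N (a + b) =
  \sum_(i < N) a ^+ i / i`!%:R * (exp_partial N b - exp_partial (N - i) b).
Proof.
rewrite exp_partialD /exp_partial mulr_suml -sumrB.
by apply: eq_bigr => i _; rewrite mulrBr.
Qed.

Lemma normc_exp_coeff (R : realType) (z : R[i]) n :
  normc (z ^+ n / n`!%:R) = normc z ^+ n / n`!%:R.
Proof. by rewrite normcM normcV normcX normc_nat. Qed.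

Lemma normc_exp_partial_sub (R : realType) M N (z : R[i]) : (M <= N)%N ->
  normc (exp_partial N z - exp_partial M z) <=
  exp_partial N (normc z) - exp_partial M (normc z).
Proof.
move=> MN; rewrite !exp_partial_sub// (le_trans (normc_sum _ _ _))//.
by apply: ler_sum => n _; rewrite normc_exp_coeff.
Qed.

Lemma normc_exp_partial_mul_sub (R : realType) N (a b : R[i]) :
  normc (exp_partial N a * exp_partial N b - exp_partial N (a + b)) <=
  exp_partial N (normc a) * exp_partial N (normc b) -
    exp_partial N (normc a + normc b).
Proof.
rewrite !exp_partial_mul_sub (le_trans (normc_sum _ _ _))//.
apply: ler_sum => i _; rewrite normcM normc_exp_coeff ler_wpM2l//.
  by rewrite divr_ge0 ?exprn_ge0 ?normc_ge0.
by rewrite normc_exp_partial_sub ?leq_subr.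
Qed.

Lemma exp_partialE (R : realType) (a : R) :
  (exp_partial (F:=R))^~ a = series (exp_coeff a).
Proof. by apply/funext => N; rewrite /series /= big_mkord. Qed.

Lemma cvg_exp_partial_real (R : realType) (a : R) :
  (exp_partial (F:=R))^~ a @ \oo --> expR a.
Proof. by rewrite exp_partialE; exact: is_cvg_series_exp_coeff. Qed.

Lemma exp_partial_le_expR (R : realType) N (a : R) : 0 <= a ->
  exp_partial N a <= expR a.
Proof.
move=> a0; rewrite -[exp_partial N a]/((exp_partial (F:=R))^~ a N) exp_partialE.
apply: nondecreasing_cvgn_le; last exact: is_cvg_series_exp_coeff.
apply/nondecreasing_seqP => n; rewrite -exp_partialE exp_partialS lerDl.
by rewrite divr_ge0 ?exprn_ge0.
Qed.

Lemma expi_even (R : realType) k : ('i%C : R[i]) ^+ k.*2 = ((-1) ^+ k)%:C.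
Proof. by rewrite -mul2n exprM sqr_i rmorphXn rmorphN1. Qed.

(** The two components are shaped like the signs in [cos_coeff] and [sin_coeff], so that the series
    at an imaginary argument splits into the cosine and sine series. *)
Lemma ReIm_expi (R : realType) n : ('i%C : R[i]) ^+ n =
  ((~~ odd n)%:R * (-1) ^+ n./2) +i* ((odd n)%:R * (-1) ^+ n.-1./2).
Proof.
rewrite -[in LHS](odd_double_half n); case: (boolP (odd n)) => on /=.
  have -> : n.-1./2 = n./2 by rewrite -{1}(odd_double_half n) on add1n/= doubleK.
  rewrite add1n exprS expi_even; apply/eqP; rewrite eq_complex /=.
  by rewrite !mul0r !mul1r ?mulr0 ?subrr ?subr0 ?add0r !eqxx.
by rewrite add0n expi_even mul1r mul0r.
Qed.

Lemma cvg_exp_partial_imag (R : realType) (b : R) :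
  (exp_partial (F:=R[i]))^~ (0 +i* b) @ \oo --> (cos b +i* sin b : R[i]^o).
Proof.
have E n : ((0 +i* b) : R[i]) ^+ n / n`!%:R = cos_coeff b n +i* sin_coeff b n.
  have -> : (0 +i* b : R[i]) = 'i%C * b%:C.
    by apply/eqP; rewrite eq_complex /= !mul0r !mul1r ?mulr0 ?subrr ?subr0 ?add0r !eqxx.
  rewrite exprMn ReIm_expi -rmorphXn -[n`!%:R](rmorph_nat (real_complex R)).
  rewrite -fmorphV -mulrA -rmorphM /cos_coeff /sin_coeff.
  by apply/eqP; rewrite eq_complex /= !mulr0 subr0 add0r !mulrA !eqxx.
apply: cvg_ReIm.
- rewrite [X in X @ _ --> _](_ : _ = series (cos_coeff b)).
    by rewrite unlock; exact: is_cvg_series_cos_coeff.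
  apply/funext => N; rewrite Re_sum /series/= big_mkord.
  by apply: eq_bigr => n _; rewrite E.
- rewrite [X in X @ _ --> _](_ : _ = series (sin_coeff b)).
    by rewrite unlock; exact: is_cvg_series_sin_coeff.
  apply/funext => N; rewrite Im_sum /series/= big_mkord.
  by apply: eq_bigr => n _; rewrite E.
Qed.

Lemma cvg_exp_partial_realc (R : realType) (a : R) :
  (exp_partial (F:=R[i]))^~ a%:C @ \oo --> ((expR a)%:C : R[i]^o).
Proof.
apply/cvg_normcP => e e0.
have /cvgrPdist_le/(_ _ e0) := @cvg_exp_partial_real R a.
apply: filterS => N; rewrite -normcR rmorphB.
suff -> : exp_partial N a%:C = (exp_partial N a)%:C by [].
rewrite /exp_partial (rmorph_sum (real_complex R)); apply: eq_bigr => n _.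
by rewrite rmorphM rmorphXn fmorphV rmorph_nat.
Qed.

(* The defect of multiplicativity of the truncated exponential is a polynomial
   with nonnegative coefficients, so it is dominated by the real defect, which
   tends to 0 because [expR] is multiplicative. *)
Lemma cvg_exp_partial (R : realType) (z : R[i]) :
  (exp_partial (F:=R[i]))^~ z @ \oo --> (cexp z : R[i]^o).
Proof.
case: z => a b.
have -> : (a +i* b : R[i]) = a%:C + (0 +i* b).
  by apply/eqP; rewrite eq_complex /= addr0 add0r !eqxx.
have lim1 : (fun N => exp_partial N a%:C * exp_partial N (0 +i* b)) @ \oo -->
    (cexp (a%:C + (0 +i* b)) : R[i]^o).
  have -> : cexp (a%:C + (0 +i* b)) = (expR a)%:C * (cos b +i* sin b).
    by rewrite /cexp /= addr0 add0r.
  exact: (@cvgM R[i] _ _ _ _ _ _ _ (@cvg_exp_partial_realc R a)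
    (@cvg_exp_partial_imag R b)).
have lim2 : (fun N => exp_partial N (normc a%:C) * exp_partial N (normc (0 +i* b)) -
    exp_partial N (normc a%:C + normc (0 +i* b))) @ \oo -->
    expR (normc a%:C) * expR (normc (0 +i* b)) - expR (normc a%:C + normc (0 +i* b)).
  exact: cvgB (cvgM (@cvg_exp_partial_real R _) (@cvg_exp_partial_real R _))
    (@cvg_exp_partial_real R _).
rewrite expRD subrr in lim2.
apply/cvg_normcP => e e0; have e20 : 0 < e / 2 by rewrite divr_gt0.
move/cvg_normcP : lim1 => /(_ _ e20) lim1.
move/cvgrPdist_le : lim2 => /(_ _ e20); apply: filterS2 lim1 => N le1.
rewrite sub0r normrN => /(le_trans (ler_norm _)) le2.
rewrite -[_ - _](subrKA (exp_partial N a%:C * exp_partial N (0 +i* b))).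
rewrite [e]splitr (le_trans (ler_normcD _ _))// lerD//.
exact: le_trans (normc_exp_partial_mul_sub _ _ _) le2.
Qed.

(** The tail is majorised term by term by the real tail at [B]. This makes the truncation error
    uniform over a bounded set of arguments. *)
Lemma cexp_tail_le (R : realType) N (z : R[i]) (B : R) : normc z <= B ->
  normc (cexp z - exp_partial N z) <= expR B - exp_partial N B.
Proof.
move=> zB; have B0 : 0 <= B := le_trans (normc_ge0 z) zB.
apply/ler_addgt0Pr => e e0; have /cvg_normcP/(_ _ e0) := @cvg_exp_partial R z.
(* The order [maxn M N] is large enough for [e]-closeness to [cexp z], and at least [N], so that the
   difference of truncations is a finite block of the tail. *)
move=> [M _ /(_ (maxn M N))] /=; rewrite leq_maxl => /(_ isT) le1.
rewrite -[_ - _](subrKA (exp_partial (maxn M N) z)) [leRHS]addrC.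
rewrite (le_trans (ler_normcD _ _))// lerD//.
have NM := leq_maxr M N; apply: le_trans (normc_exp_partial_sub _ NM) _.
apply: le_trans (_ : exp_partial (maxn M N) B - exp_partial N B <= _); last first.
  by rewrite lerD2r exp_partial_le_expR.
rewrite !exp_partial_sub//; apply: ler_sum => n _.
by rewrite ler_wpM2r ?invr_ge0// lerXn2r// nnegrE normc_ge0.
Qed.

(** * Absolute summability of geometric weights over [r]-tuples *)

(** The cube {0, ..., N-1}^r, listed as plain sequences so that induction on [r] peels off one
    coordinate. *)
Fixpoint box (N r : nat) : seq (seq nat) :=
  if r is r'.+1 then [seq i :: m | i <- iota 0 N, m <- box N r'] else [:: [::]].

Lemma box_uniq N r : uniq (box N r).
Proof.
elim: r => //= r IH; apply: allpairs_uniq; rewrite ?iota_uniq//.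
by move=> [i m] [j m'] _ _ /= [-> ->].
Qed.

Lemma mem_box N (s : seq nat) : all (fun i => i < N)%N s -> s \in box N (size s).
Proof.
elim: s => //= i s IH /andP[iN /IH sN].
by apply/allpairsP; exists (i, s); rewrite mem_iota.
Qed.

(** The weight is a product over the coordinates, so the sum over the cube factors. *)
Lemma sum_box (F : pzRingType) (a : F) N r :
  \sum_(s <- box N r) a ^+ sumn s = (\sum_(i < N) a ^+ i) ^+ r.
Proof.
elim: r => [|r IH] /=; first by rewrite big_seq1.
rewrite big_allpairs_dep/= exprS -IH mulr_suml -(big_mkord xpredT (fun i =>
  a ^+ i * \sum_(s <- box N r) a ^+ sumn s)) /index_iota subn0.
by apply: eq_bigr => i _; rewrite mulr_sumr; apply: eq_bigr => s _; rewrite exprD.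
Qed.

Lemma geometric_sum_le (R : realType) (a : R) N : 0 <= a < 1 ->
  \sum_(i < N) a ^+ i <= (1 - a)^-1.
Proof.
move=> /andP[a0 a1]; have a1' : 0 < 1 - a by rewrite subr_gt0.
rewrite -[leRHS]mul1r ler_pdivlMr// mulrC -opprB mulNr -subrX1 opprB.
by rewrite gerBl exprn_ge0.
Qed.

(** A finite set of tuples lies in some cube, where the sum is a power of a truncated geometric
    series. *)
Lemma partial_sum_geometric_le (R : realType) (a : R) r (A : {fset r.-tuple nat}) :
  0 <= a < 1 ->
  partial_sum (fun m : r.-tuple nat => a ^+ sumn m) A <= (1 - a)^-1 ^+ r.
Proof.
move=> a01; have /andP[a0 a1] := a01; rewrite partial_sumE.
(* One more than the total of all entries of all tuples in [A], hence larger than each entry. *)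
pose N := (\sum_(m <- A) \sum_(i <- (m : r.-tuple nat)) i).+1.
apply: le_trans (_ : (\sum_(i < N) a ^+ i) ^+ r <= _); last first.
  apply: lerXn2r; rewrite ?nnegrE; last exact: geometric_sum_le.
    by rewrite sumr_ge0// => i _; rewrite exprn_ge0.
  by rewrite invr_ge0 subr_ge0 ltW.
rewrite -sum_box -(big_map val xpredT (fun s => a ^+ sumn s)).
apply: ler_sum_uniq_sub; rewrite ?box_uniq ?exprn_ge0//.
- by rewrite map_inj_uniq ?fset_uniq//; exact: val_inj.
- move=> _ /mapP[m mA ->]; rewrite -[X in box _ X](size_tuple m).
  apply/mem_box/allP => i im; rewrite ltnS.
  apply: leq_trans (_ : \sum_(i <- (m : r.-tuple nat)) i <= _)%N.
    by rewrite (big_rem i im) leq_addr.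
  by rewrite (big_rem m mA) leq_addr.
- by move=> s; rewrite exprn_ge0.
Qed.

(** * Uniqueness of power series coefficients *)

(** Convergence at 1 bounds the coefficients by some [M]. At a small positive [t], the first nonzero
    term would then outweigh all later ones together, so the sum could not vanish. *)
Lemma cvg0_power_series_coef (R : realType) (c : nat -> R[i]) :
  (forall t : R[i], series (fun n => c n * t ^+ n) @ \oo --> (0 : R[i]^o)) ->
  forall n, c n = 0.
Proof.
move=> c0.
have {}c0 t : forall e : R, 0 < e -> \forall N \near \oo,
    normc (\sum_(n < N) c n * t ^+ n) <= e.
  move=> e e0; have /cvg_normcP/(_ _ e0) := c0 t.
  apply: filterS => N; rewrite sub0r normcN /series /=.
  by rewrite (big_mkord xpredT (fun n => c n * t ^+ n)).
have [M cM] : exists M, forall n, normc (c n) <= M.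
  have [N0 _ N0P] := c0 1 _ ltr01.
  (* From [N0] on, [c n] is a difference of two partial sums at 1, each of modulus at most 1;
     earlier coefficients are bounded by their total. *)
  exists (2 + \sum_(n < N0) normc (c n)) => n.
  have [N0n|nN0] := leqP N0 n.
    apply: ler_wpDr; first by rewrite sumr_ge0// => i _; rewrite normc_ge0.
    have := N0P n.+1 (leqW N0n); have := N0P n N0n.
    rewrite /= big_ord_recr/= expr1n mulr1; set s := \sum_(i < n) _ => s1 sn1.
    rewrite -[c n](addKr s) (le_trans (ler_normcD _ _))// normcN.
    by rewrite -[2]/(1 + 1) lerD.
  rewrite (bigD1 (Ordinal nN0))//= addrCA lerDl addr_ge0// sumr_ge0// => i _.
  exact: normc_ge0.
move=> k; have [m] := ubnP k; elim: m k => // m IH k; rewrite ltnS => km.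
apply/eq0_normc/eqP/negPn/negP => ck0.
have ck : 0 < normc (c k) by rewrite lt_def ck0 normc_ge0.
have M0 : 0 < M := lt_le_trans ck (cM k).
(* This choice gives 2 M t = |c_k| / 2, which contradicts the inequality below, and t <= 1/2, which
   bounds the geometric series in [t] by 2. *)
pose t : R := normc (c k) / (4 * M).
have t0 : 0 < t by rewrite divr_gt0// mulr_gt0.
have t1 : t <= 1 / 2.
  rewrite ler_pdivrMr ?mulr_gt0//; have := cM k; lra.
suff : normc (c k) * t ^+ k <= 2 * M * t ^+ k.+1.
  rewrite exprSr mulrCA mulrC ler_pM2l ?exprn_gt0// leNgt => /negP; apply.
  rewrite /t; have -> : 2 * M * (normc (c k) / (4 * M)) = normc (c k) / 2.
    by field; rewrite gt_eqF.
  lra.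
apply/ler_addgt0Pr => e e0.
have [N0 _ N0P] := c0 t%:C _ e0.
(* The partial sum splits into the terms below [k], zero by induction, the term at [k], and [N0]
   later terms collected in [S]. *)
have := N0P (k.+1 + N0)%N (leq_addl _ _); rewrite /= big_split_ord/=.
rewrite big_ord_recr/= big1 ?add0r; last first.
  by move=> i _; rewrite IH ?mul0r// (leq_trans (ltn_ord i)).
set S := \sum_(i < N0) _ => le1.
have S2 : normc S <= 2 * M * t ^+ k.+1.
  rewrite (le_trans (normc_sum _ _ _))//.
  apply: le_trans (_ : \sum_(i < N0) M * t ^+ k.+1 * t ^+ i <= _).
    apply: ler_sum => i _; rewrite normcM normcX normcR gtr0_norm// exprD mulrA.
    by rewrite ler_pM2r ?exprn_gt0// ler_pM2r ?exprn_gt0.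
  rewrite -mulr_sumr [2 * M]mulrC -!mulrA ler_pM2l// [2 * _]mulrC ler_pM2l ?exprn_gt0//.
  apply: le_trans (geometric_sum_le _ _) _; first by apply/andP; split; lra.
  rewrite -[leRHS]invrK lef_pV2 ?posrE; lra.
have -> : normc (c k) * t ^+ k = normc (c k * t%:C ^+ k).
  by rewrite normcM normcX normcR gtr0_norm.
rewrite -[_ * _](addrK S) (le_trans (ler_normcD _ _))// normcN addrC lerD//.
Qed.

(** The difference of the two series tends to 0 everywhere; its coefficients are those of [E - E']
    divided by the nonzero factorials. *)
Lemma exp_series_coef_unique (R : realType) (E E' : nat -> R[i]) (G : R[i] -> R[i]) :
  (forall t, series (fun n => E n * (t ^+ n / n`!%:R)) @ \oo --> (G t : R[i]^o)) ->
  (forall t, series (fun n => E' n * (t ^+ n / n`!%:R)) @ \oo --> (G t : R[i]^o)) ->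
  E = E'.
Proof.
move=> EG E'G; apply/funext => n; apply/eqP; rewrite -subr_eq0; apply/eqP.
have f0 : n`!%:R != 0 :> R[i] by rewrite pnatr_eq0 -lt0n fact_gt0.
apply: (mulIf (invr_neq0 f0)); rewrite mul0r; move: n {f0}.
apply: (@cvg0_power_series_coef R (fun n => (E n - E' n) / n`!%:R)) => t.
have := @cvgB R[i] R[i]^o _ _ _ _ _ _ _ (EG t) (E'G t); rewrite subrr => EE'.
suff -> : series (fun n => (E n - E' n) / n`!%:R * t ^+ n) =
    series (fun n => E n * (t ^+ n / n`!%:R)) - series (fun n => E' n * (t ^+ n / n`!%:R)).
  exact: EE'.
apply/funext => N; rewrite !fctE /series /= -sumrB.
by apply: eq_bigr => n _; rewrite -mulrBl mulrA mulrAC.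
Qed.

(** * Termwise summation of exponential moments *)

(* Truncating the exponential at order [N] costs at most the tail of
   [expR (B * normc t)], uniformly in [i], so both summations can be exchanged. *)
Lemma cvg_exp_moments (R : realType) (I : choiceType) (c w : I -> R[i]) (K B : R)
    (t : R[i]) :
  (forall A : {fset I}, partial_sum (fun i => normc (c i)) A <= K) -> 0 <= B ->
  (forall i, normc (w i) <= B) ->
  series (fun n => @sum I R[i] R[i]^o (fun i => c i * w i ^+ n) * (t ^+ n / n`!%:R)) @ \oo
    --> (@sum I R[i] R[i]^o (fun i => c i * cexp (w i * t)) : R[i]^o).
Proof.
move=> cK B0 wB; have FF := @totally_filter I.
have K0 : 0 <= K by rewrite (le_trans _ (cK fset0))// sumr_ge0// => i _; exact: normc_ge0.
(* A bounded factor preserves absolute summability; this covers both the moments and the exponential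
   sum. *)
have domM (d : I -> R[i]) D : 0 <= D -> (forall i, normc (d i) <= D) ->
    partial_sum (fun i => c i * d i) @ totally -->
    (@sum I R[i] R[i]^o (fun i => c i * d i) : R[i]^o).
  move=> D0 dD; apply: (@complex_partial_sum_cvg_dominated _ _ _
    (fun i => normc (c i) * D) (K * D)) => [i|A].
    by rewrite normcM ler_wpM2l ?normc_ge0.
  by rewrite /partial_sum -mulr_suml ler_wpM2r//; exact: cK.
pose D := B * normc t; have D0 : 0 <= D by rewrite mulr_ge0 ?normc_ge0.
have wtD i : normc (w i * t) <= D by rewrite normcM ler_wpM2r ?normc_ge0.
have limS n : partial_sum (fun i => c i * w i ^+ n) @ totally -->
    (@sum I R[i] R[i]^o (fun i => c i * w i ^+ n) : R[i]^o).
  apply: (domM _ (B ^+ n)); first by rewrite exprn_ge0.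
  by move=> i; rewrite normcX lerXn2r ?nnegrE ?normc_ge0.
have limG : partial_sum (fun i => c i * cexp (w i * t)) @ totally -->
    (@sum I R[i] R[i]^o (fun i => c i * cexp (w i * t)) : R[i]^o).
  apply: (domM _ (expR D)); first exact: expR_ge0.
  move=> i; rewrite normc_cexp ler_expR.
  exact: le_trans (ler_norm _) (le_trans (normRe_le_normc _) (wtD i)).
pose S n := @sum I R[i] R[i]^o (fun i => c i * w i ^+ n).
pose G := @sum I R[i] R[i]^o (fun i => c i * cexp (w i * t)).
have limSN N : (fun A : {fset I} => \sum_(n < N)
      partial_sum (fun i => c i * w i ^+ n) A * (t ^+ n / n`!%:R)) @ totally -->
    (\sum_(n < N) S n * (t ^+ n / n`!%:R) : R[i]^o).
  elim: N => [|N IH].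
    by under eq_fun do rewrite big_ord0; rewrite big_ord0; exact: (@cvg_cst R[i]^o).
  under eq_fun do rewrite big_ord_recr/=; rewrite big_ord_recr/=.
  apply: (@cvgD R[i] R[i]^o _ _ _ _ _ _ _ IH).
  exact: (@cvgMr_tmp R[i] _ _ _ _ _ _ (limS N)).
have bound N : normc (G - \sum_(n < N) S n * (t ^+ n / n`!%:R)) <=
    K * (expR D - exp_partial N D).
  have cvgA : (fun A : {fset I} => partial_sum (fun i => c i * cexp (w i * t)) A -
      \sum_(n < N) partial_sum (fun i => c i * w i ^+ n) A * (t ^+ n / n`!%:R))
      @ totally --> (G - \sum_(n < N) S n * (t ^+ n / n`!%:R) : R[i]^o).
    exact: (@cvgB R[i] R[i]^o _ _ _ _ _ _ _ limG (limSN N)).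
  apply: (normc_cvg_le cvgA) => A.
  (* Over a finite [A] the two sums commute, leaving one exponential tail per index. *)
  have -> : partial_sum (fun i => c i * cexp (w i * t)) A -
      \sum_(n < N) partial_sum (fun i => c i * w i ^+ n) A * (t ^+ n / n`!%:R) =
      \sum_(i : A) c (val i) * (cexp (w (val i) * t) - exp_partial N (w (val i) * t)).
    under [X in _ - X]eq_bigr do rewrite /partial_sum mulr_suml.
    rewrite exchange_big/= /partial_sum -sumrB; apply: eq_bigr => i _.
    rewrite mulrBr /exp_partial mulr_sumr; congr (_ - _).
    by apply: eq_bigr => n _; rewrite exprMn !mulrA.
  rewrite (le_trans (normc_sum _ _ _))//.
  apply: le_trans (_ : \sum_(i : A) normc (c (val i)) * (expR D - exp_partial N D) <= _).
    apply: ler_sum => i _; rewrite normcM ler_wpM2l ?normc_ge0//.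
    exact: cexp_tail_le.
  rewrite -mulr_suml ler_wpM2r ?subr_ge0 ?exp_partial_le_expR//; exact: cK.
have : (fun N => K * (expR D - exp_partial N D)) @ \oo --> K * (expR D - expR D).
  exact: cvgM (@cvg_cst _ _ _ _ _)
    (cvgB (@cvg_cst _ _ _ _ _) (@cvg_exp_partial_real R D)).
rewrite subrr mulr0 => lim0; apply/cvg_normcP => e e0.
move/cvgrPdist_le : lim0 => /(_ _ e0); apply: filterS => N.
rewrite sub0r normrN => /(le_trans (ler_norm _)); apply: le_trans.
by rewrite /series /= big_mkord; exact: bound.
Qed.

(** * The q-numbers, complex powers and the final identification *)

Lemma qnum_natD (R : realType) (q logq y : R[i]) k : cexp logq = q ->
  qnum q logq (k%:R + y) = (1 - q ^+ k * cexp (y * logq)) / (1 - q).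
Proof. by move=> <-; rewrite /qnum [(_ + _) * logq]mulrDl cexpD cexp_natl. Qed.

(** The factor [q ^+ k] has modulus at most 1, so the bound is uniform in [k], as the bound [B] in
    [cvg_exp_moments] has to be. *)
Lemma normc_qnum_le (R : realType) (q logq y : R[i]) k :
  normc q <= 1 -> cexp logq = q ->
  normc (qnum q logq (k%:R + y)) <= (1 + normc (cexp (y * logq))) / normc (1 - q).
Proof.
move=> q1 ql; rewrite qnum_natD// normcM normcV ler_wpM2r ?invr_ge0 ?normc_ge0//.
rewrite (le_trans (ler_normcD _ _))// normc1 normcN normcM normcX lerD2l.
by rewrite ler_piMl ?normc_ge0// exprn_ile1 ?normc_ge0.
Qed.

(** For real [y] the modulus of q^y is exp(y Re(log q)), and Re(log q) < 0 because |q| < 1; it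
    equals 1 only at y = 0. *)
Lemma qnum_neq0 (R : realType) (q logq : R[i]) (y : R) :
  normc q < 1 -> cexp logq = q -> y != 0 -> qnum q logq y%:C != 0.
Proof.
move=> q1 ql y0.
have q1' : 1 - q != 0.
  by rewrite subr_eq0 eq_sym; apply: contraTneq q1 => ->; rewrite normc1 ltxx.
rewrite mulf_neq0 ?invr_neq0// subr_eq0 eq_sym; apply/eqP => /(congr1 (@normc R)).
rewrite normc1 normc_cexp -expR0 => /expR_inj.
have : expR (complex.Re logq) < 1 by rewrite -normc_cexp ql.
rewrite expR_lt1; case: (logq) => a b /= a0 /eqP.
by rewrite mul0r subr0 mulf_eq0 (negbTE y0) lt_eqF.
Qed.

(** At integer exponents the choice of logarithm disappears, since [cexp (Log w)] is [w]. *)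
Lemma cpowNn (R : realType) (Log : R[i] -> R[i]) (w : R[i]) n :
  is_logarithm Log -> w != 0 -> cpow Log w (- n%:R) = w ^- n.
Proof. by move=> L w0; rewrite /cpow mulNr cexpN cexp_natl L. Qed.

Theorem theorem3 (R : realType) (q logq : R[i]) (Log : R[i] -> R[i])
    (r n : nat) (x : R) :
  `|q| < 1 ->
  cexp logq = q ->
  is_logarithm Log ->
  (0 < r)%N ->
  (forall k : nat, x <> - k%:R) ->
  qzeta Log q logq r (- n%:R) x = qEuler q logq r x n.
Proof.
move=> q1 ql LogP _ xk; have {}q1 : normc q < 1 by rewrite -ltcR.
pose c (m : r.-tuple nat) := (- q) ^+ sumn m.
pose w (m : r.-tuple nat) := qnum q logq ((sumn m)%:R + x%:C).
pose E k := qnum q logq 2 ^+ r * multisum (fun m => c m * w m ^+ k).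
have cK (A : {fset r.-tuple nat}) :
    partial_sum (fun m => normc (c m)) A <= (1 - normc q)^-1 ^+ r.
  rewrite [partial_sum _](_ : _ = partial_sum (fun m : r.-tuple nat => normc q ^+ sumn m)).
    by apply: partial_sum_geometric_le; rewrite normc_ge0.
  by congr partial_sum; apply/funext => m; rewrite normcX normcN.
have wB m : normc (w m) <= (1 + normc (cexp (x%:C * logq))) / normc (1 - q).
  by apply: normc_qnum_le => //; exact: ltW.
have B0 : 0 <= (1 + normc (cexp (x%:C * logq))) / normc (1 - q).
  by rewrite divr_ge0 ?addr_ge0 ?normc_ge0.
have EP t : series (fun k => E k * (t ^+ k / k`!%:R)) @ \oo -->
    (qEuler_gf q logq r x t : R[i]^o).
  have lim := @cvgMl_tmp R[i] _ _ _ _ (qnum q logq 2 ^+ r) _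
    (cvg_exp_moments (t := t) cK B0 wB).
  have -> : series (fun k => E k * (t ^+ k / k`!%:R)) = fun N => qnum q logq 2 ^+ r *
      series (fun k => multisum (fun m => c m * w m ^+ k) * (t ^+ k / k`!%:R)) N.
    apply/funext => N; rewrite /series /= mulr_sumr.
    by apply: eq_bigr => k _; rewrite mulrA.
  exact: lim.
(* [E] belongs to the set defining [qEuler], so [xget] returns a member rather than its default, and
   uniqueness of coefficients makes that member [E]. *)
have -> : qEuler q logq r x = E.
  apply: (@exp_series_coef_unique R _ _ (qEuler_gf q logq r x) _ EP).
  apply: (@xgetPex _ (fun=> 0) [set E' : nat -> R[i] | forall t : R[i],
    series (fun k => E' k * (t ^+ k / k`!%:R) : R[i]^o) @ \oo
      --> (qEuler_gf q logq r x t : R[i]^o)]).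
  by exists E; exact: EP.
congr (_ * multisum _); apply/funext => m.
rewrite cpowNn ?invrK// -[_%:R](rmorph_nat (real_complex R)) -rmorphD qnum_neq0//.
by rewrite addrC addr_eq0; apply/eqP; exact: xk.
Qed.
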